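(* Let $f:\mathsf X\to\mathsf X$ be a Lipschitz mapping with Lipschitz constant $\mathfrak l(f)>0$. Then the mapping $\hat f:\widehat{\mathsf X}\to\widehat{\mathsf X}$ defined by $$\hat f(x,a)=\bigl(f(x),\mathfrak l(f)a\bigr)$$ is a contraction of $(\widehat{\mathsf X},\hat d)$ with Lipschitz constant $1$.
   Context: $(\mathsf X,d)$ is a proper metric space (closed balls are compact). $\widehat{\mathsf X}=\mathsf X\times(0,\infty)$ (non-lattice case), or, in the lattice case, $\widehat{\mathsf X}=\mathsf X\times\{e^{\kappa m}:m\in\mathbb Z\}$ for a fixed $\kappa>0$, where only maps $f$ with $\log\mathfrak l(f)\in\kappa\mathbb Z$ are considered. The metric on $\widehat{\mathsf X}$ is $$\hat d\bigl((x,a),(y,b)\bigr)=\log\frac{\sqrt{d(x,y)^2+(a+b)^2}+\sqrt{d(x,y)^2+(a-b)^2}}{\sqrt{d(x,y)^2+(a+b)^2}-\sqrt{d(x,y)^2+(a-b)^2}},$$ i.e. $\hat d((x,a),(y,b))=\theta(\mathrm i a,d(x,y)+\mathrm i b)$, where $\theta$ is the Poincaré metric $\theta(z,w)=\log\frac{|z-\bar w|+|z-w|}{|z-\bar w|-|z-w|}$ on the upper half plane. A contraction is a map with Lipschitz constant at most $1$. *)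

(* Defs.v *)
From mathcomp Require Import all_boot all_order all_algebra.
From mathcomp Require Import all_classical all_reals all_analysis.

Set Implicit Arguments.
Unset Strict Implicit.
Unset Printing Implicit Defensive.

Import Order.TTheory GRing.Theory Num.Theory.
Import numFieldNormedType.Exports.

Local Open Scope classical_set_scope.
Local Open Scope ring_scope.

(* The library's [closed_ball] is the closure of the open ball, which may be
   smaller than the metric closed ball used here. *)
Definition proper_metric (R : realType) (X : metricType R) : Prop :=
  forall (x : X) (r : R), compact [set y | mdist x y <= r].

(* Lipschitz notions for a self-map of the subset [A] of [T], relative to an
   explicit distance function [d]; the library's versions are restricted to
   normed modules. *)
Definition lipschitz_wrt (R : realType) (T : Type) (d : T -> T -> R)
    (A : set T) (f : T -> T) : Prop :=
  exists k : R, forall x y, A x -> A y -> d (f x) (f y) <= k * d x y.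

(* The optimal constant. [sup] is 0 on an empty or unbounded set, so this is
   only meaningful together with [lipschitz_wrt]. *)
Definition lipschitz_const (R : realType) (T : Type) (d : T -> T -> R)
    (A : set T) (f : T -> T) : R :=
  sup [set r | exists x y, [/\ A x, A y, x <> y & r = d (f x) (f y) / d x y]].

(* Weak contraction (constant at most 1), unlike the library's [contraction],
   which asks for a constant less than 1. *)
Definition weak_contraction (R : realType) (T : Type) (d : T -> T -> R)
    (A : set T) (f : T -> T) : Prop :=
  [/\ set_fun A A f, lipschitz_wrt d A f & lipschitz_const d A f <= 1].

Section HatSpace.
Context {R : realType} {X : metricType R}.

Definition hat_space : set (X * R) := [set p | 0 < p.2].

Definition hat_space_lattice (kappa : R) : set (X * R) :=
  [set p | exists m : int, p.2 = expR (kappa * m%:~R)].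

(* Meaningful for positive second coordinates: the denominator is then
   positive. *)
Definition hat_dist (p q : X * R) : R :=
  let r := mdist p.1 q.1 in
  let u := Num.sqrt (r ^+ 2 + (p.2 + q.2) ^+ 2) in
  let v := Num.sqrt (r ^+ 2 + (p.2 - q.2) ^+ 2) in
  ln ((u + v) / (u - v)).

Definition lip (f : X -> X) : R := lipschitz_const (@mdist R X) setT f.

Definition hat_map (f : X -> X) (p : X * R) : X * R := (f p.1, lip f * p.2).

End HatSpace.

Arguments hat_space {R} X.
Arguments hat_space_lattice {R} X kappa.

(* Main.v *)
(** In the notation of [hat_dist], [u^2 - v^2 = 4 a b], so the argument of the
    logarithm defining the distance of [(x, a)] and [(y, b)] equals
    [(u + v)^2 / (4 a b)]. In this form it is visibly nondecreasing in
    [r = d(x, y)] and homogeneous of degree 0 in [(r, a, b)], so the map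
    [(x, a) |-> (f x, l a)] cannot increase distances; on a vertical pair
    [(x, a)], [(x, b)] homogeneity gives equality. *)

Require Import Defs.
From mathcomp Require Import all_boot all_order all_algebra.
From mathcomp Require Import all_classical all_reals all_analysis.
From mathcomp Require Import ring lra.

Set Implicit Arguments.
Unset Strict Implicit.
Unset Printing Implicit Defensive.

Import Order.TTheory GRing.Theory Num.Theory.
Import numFieldNormedType.Exports.

Local Open Scope classical_set_scope.
Local Open Scope ring_scope.

Section LipschitzConst.
Context {R : realType} {T : Type} (d : T -> T -> R) (A : set T) (f : T -> T).
Hypothesis d_gt0 : forall x y, A x -> A y -> x <> y -> 0 < d x y.

Lemma lipschitz_ratio_le {k : R} :
    (forall x y, A x -> A y -> d (f x) (f y) <= k * d x y) ->
  ubound [set r | exists x y, [/\ A x, A y, x <> y & r = d (f x) (f y) / d x y]]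
    k.
Proof.
move=> fk _ [x [y [Ax Ay xy ->]]].
by rewrite ler_pdivrMr ?d_gt0// fk.
Qed.

(** Any admissible constant bounds the set of ratios, so its [sup] is a genuine upper bound and not
    the default 0. *)
Lemma le_lipschitz_const x y : lipschitz_wrt d A f -> A x -> A y -> x <> y ->
  d (f x) (f y) <= lipschitz_const d A f * d x y.
Proof.
move=> [k fk] Ax Ay xy; rewrite -ler_pdivrMr ?d_gt0//.
apply: ub_le_sup; first by exists k; exact: lipschitz_ratio_le.
by exists x, y.
Qed.

(** The pair on which [f] preserves [d] puts 1 among the ratios, and 1 bounds them all, so it is
    their maximum. *)
Lemma lipschitz_const1 x y :
    (forall x y, A x -> A y -> d (f x) (f y) <= d x y) ->
    A x -> A y -> x <> y -> d (f x) (f y) = d x y ->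
  lipschitz_const d A f = 1.
Proof.
move=> f1 Ax Ay xy fxy.
have ub1 : ubound [set r | exists x y,
    [/\ A x, A y, x <> y & r = d (f x) (f y) / d x y]] 1.
  by apply: lipschitz_ratio_le => x' y' Ax' Ay'; rewrite mul1r f1.
have mem1 : exists x y, [/\ A x, A y, x <> y & 1 = d (f x) (f y) / d x y].
  by exists x, y; split=> //; rewrite fxy divff// gt_eqF// d_gt0.
apply/eqP; rewrite eq_le; apply/andP; split.
  by apply: ge_sup ub1; exists 1.
by apply: ub_le_sup mem1; exists 1.
Qed.

End LipschitzConst.

Section LipMetric.
Context {R : realType} {X : metricType R} (f : X -> X).

Lemma mdist_lip x y : lipschitz_wrt (@mdist R X) setT f ->
  mdist (f x) (f y) <= lip f * mdist x y.
Proof.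
move=> f_lip; have [->|/eqP xy] := eqVneq x y.
  by rewrite !mdistxx mulr0.
apply: le_lipschitz_const => // x' y' _ _ /eqP.
by rewrite mdist_gt0.
Qed.

(** On an empty space there are no ratios, and [sup] takes its default value 0. The point obtained
    carries the vertical pair on which equality holds. *)
Lemma lip_gt0_inhabited : 0 < lip f -> exists x : X, True.
Proof.
rewrite /lip /lipschitz_const; set S := [set _ | _] => S0.
have [SE|/set0P[_ [x _]]] := eqVneq S set0; last by exists x.
by rewrite SE sup0 ltxx in S0.
Qed.

End LipMetric.

Section HatDist.
Context {R : realType} {X : metricType R}.
Implicit Types p q : X * R.

Let u (r a b : R) := Num.sqrt (r ^+ 2 + (a + b) ^+ 2).
Let v (r a b : R) := Num.sqrt (r ^+ 2 + (a - b) ^+ 2).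

Let u2 r a b : u r a b ^+ 2 = r ^+ 2 + (a + b) ^+ 2.
Proof. by rewrite sqr_sqrtr// addr_ge0// sqr_ge0. Qed.

Let v2 r a b : v r a b ^+ 2 = r ^+ 2 + (a - b) ^+ 2.
Proof. by rewrite sqr_sqrtr// addr_ge0// sqr_ge0. Qed.

Let u_gt0 r a b : 0 < a -> 0 < b -> 0 < u r a b.
Proof.
move=> a0 b0; rewrite sqrtr_gt0 ltr_wpDl ?sqr_ge0//.
by rewrite exprn_gt0// addr_gt0.
Qed.

Lemma hat_distE p q : 0 < p.2 -> 0 < q.2 ->
  hat_dist p q =
  ln ((u (mdist p.1 q.1) p.2 q.2 + v (mdist p.1 q.1) p.2 q.2) ^+ 2
      / (4 * (p.2 * q.2))).
Proof.
move=> a0 b0; rewrite /hat_dist -/(u _ _ _) -/(v _ _ _).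
set r := mdist _ _; move: p.2 q.2 a0 b0 => a b a0 b0.
have U := u2 r a b; have V := v2 r a b; have U0 := u_gt0 r a0 b0.
have V0 : 0 <= v r a b by exact: sqrtr_ge0.
have ab0 : 0 < a * b by exact: mulr_gt0.
have uvE : (u r a b + v r a b) * (u r a b - v r a b) = 4 * (a * b).
  by rewrite mulrC -subr_sqr U V; ring.
have uv0 : 0 < u r a b + v r a b by rewrite ltr_wpDr.
(* A zero factor would contradict [uvE], as [a * b] is positive. *)
have uv_neq0 : u r a b - v r a b != 0.
  apply/eqP => uv0'; move: uvE; rewrite uv0' mulr0 => /eqP.
  by rewrite eq_sym mulf_eq0 pnatr_eq0/= gt_eqF.
congr ln; rewrite -uvE; field.
by rewrite uv_neq0 gt_eqF.
Qed.

Lemma hat_dist_gt0 p q : 0 < p.2 -> 0 < q.2 -> p <> q -> 0 < hat_dist p q.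
Proof.
move=> a0 b0 pq; rewrite hat_distE//.
have V0 : 0 < v (mdist p.1 q.1) p.2 q.2.
  rewrite sqrtr_gt0 lt0r addr_ge0 ?sqr_ge0// andbT.
  rewrite paddr_eq0 ?sqr_ge0// !sqrf_eq0 subr_eq0.
  apply/negP => /andP[/eqP /mdist_positivity pq1 /eqP pq2]; apply: pq.
  by rewrite [p]surjective_pairing [q]surjective_pairing pq1 pq2.
have U := u2 (mdist p.1 q.1) p.2 q.2; have V := v2 (mdist p.1 q.1) p.2 q.2.
have U0 := u_gt0 (mdist p.1 q.1) a0 b0.
apply: ln_gt0; rewrite ltr_pdivlMr ?mul1r; last by rewrite !mulr_gt0.
(* Since [4ab = u^2 - v^2], the difference [(u + v)^2 - 4ab] equals [2v(u + v)], which is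
   positive. *)
nra.
Qed.

(** The image points are arbitrary rather than values of [hat_map f], so that the lemma applies both
    with [lip f] and, on vertical pairs, with its inverse. *)
Lemma le_hat_dist (l : R) p q p' q' : 0 < l -> 0 < p.2 -> 0 < q.2 ->
    p'.2 = l * p.2 -> q'.2 = l * q.2 ->
    mdist p'.1 q'.1 <= l * mdist p.1 q.1 ->
  hat_dist p' q' <= hat_dist p q.
Proof.
move=> l0 a0 b0 pE qE rr.
have a0' : 0 < p'.2 by rewrite pE mulr_gt0.
have b0' : 0 < q'.2 by rewrite qE mulr_gt0.
rewrite !hat_distE//.
set r := mdist p.1 q.1 in rr *; set r' := mdist p'.1 q'.1 in rr *.
have r0' : 0 <= r' by exact: mdist_ge0.
have r0 : 0 <= r by exact: mdist_ge0.
have rr2 : r' ^+ 2 <= l ^+ 2 * r ^+ 2.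
  by rewrite -exprMn lerXn2r ?nnegrE// mulr_ge0// ltW.
have sqrtE x : l * Num.sqrt x = Num.sqrt (l ^+ 2 * x).
  by rewrite sqrtrM ?sqr_ge0// sqrtr_sqr gtr0_norm.
have uu : u r' p'.2 q'.2 <= l * u r p.2 q.2.
  by rewrite sqrtE ler_wsqrtr// pE qE -mulrDr exprMn mulrDr lerD2r.
have vv : v r' p'.2 q'.2 <= l * v r p.2 q.2.
  by rewrite sqrtE ler_wsqrtr// pE qE -mulrBr exprMn mulrDr lerD2r.
have U0 := u_gt0 r a0 b0; have U0' := u_gt0 r' a0' b0'.
have V0 : 0 <= v r p.2 q.2 by exact: sqrtr_ge0.
have V0' : 0 <= v r' p'.2 q'.2 by exact: sqrtr_ge0.
rewrite ler_ln ?posrE ?divr_gt0 ?exprn_gt0 ?mulr_gt0 ?ltr_wpDr//.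
(* Expanding the fraction by [l^2] gives both sides the same denominator, so only the numerators
   remain to be compared. *)
have -> : (u r p.2 q.2 + v r p.2 q.2) ^+ 2 / (4 * (p.2 * q.2)) =
    (l * u r p.2 q.2 + l * v r p.2 q.2) ^+ 2 / (4 * (p'.2 * q'.2)).
  by rewrite pE qE; field; rewrite !gt_eqF.
rewrite ler_pM2r ?invr_gt0 ?mulr_gt0//.
rewrite lerXn2r ?nnegrE ?lerD//; first by rewrite addr_ge0// ltW.
by rewrite addr_ge0// mulr_ge0// ltW.
Qed.

End HatDist.

(** Leaving [A] general treats the lattice and non-lattice cases together; each only has to supply
    stability under [hat_map f] and two distinct heights over one point. *)
Lemma hat_map_contraction (R : realType) (X : metricType R) (f : X -> X)
    (A : set (X * R)) (x : X) (a b : R) :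
    lipschitz_wrt (@mdist R X) setT f -> 0 < lip f ->
    A `<=` hat_space X -> set_fun A A (hat_map f) ->
    A (x, a) -> A (x, b) -> a <> b ->
  weak_contraction hat_dist A (hat_map f) /\
  lipschitz_const hat_dist A (hat_map f) = 1.
Proof.
move=> f_lip l0 Apos fA Axa Axb ab.
have f1 p q : A p -> A q ->
    hat_dist (hat_map f p) (hat_map f q) <= hat_dist p q.
  move=> /Apos p0 /Apos q0.
  by apply: (le_hat_dist l0) => //; exact: mdist_lip.
have c1 : lipschitz_const hat_dist A (hat_map f) = 1.
  apply: (@lipschitz_const1 _ _ _ _ _ _ (x, a) (x, b)) => //.
  - by move=> p q /Apos p0 /Apos q0; exact: hat_dist_gt0.
  - by case.
  (* The reverse inequality: rescale the image pair by [(lip f)^-1]. *)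
  apply/eqP; rewrite eq_le f1//=.
  have l0' : 0 < (lip f)^-1 by rewrite invr_gt0.
  have [la0 lb0] := (Apos _ (fA _ Axa), Apos _ (fA _ Axb)).
  apply: (le_hat_dist l0') => //=; rewrite ?mulKf ?gt_eqF//.
  by rewrite !mdistxx mulr0.
split=> //; split=> //; last by rewrite c1.
by exists 1 => p q Ap Aq; rewrite mul1r f1.
Qed.

Theorem lemma7p5 (R : realType) (X : metricType R)
    (X_proper : proper_metric X)
    (f : X -> X)
    (f_lip : lipschitz_wrt (@mdist R X) setT f)
    (lip_gt0 : 0 < lip f) :
  (weak_contraction hat_dist (hat_space X) (hat_map f) /\
   lipschitz_const hat_dist (hat_space X) (hat_map f) = 1) /\
  (forall kappa : R, 0 < kappa ->
     (exists m : int, ln (lip f) = kappa * m%:~R) ->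
     weak_contraction hat_dist (hat_space_lattice X kappa) (hat_map f) /\
     lipschitz_const hat_dist (hat_space_lattice X kappa) (hat_map f) = 1).
Proof.
have [x _] := lip_gt0_inhabited lip_gt0.
split=> [|kappa kappa0 [m0 lm0]].
  apply: (@hat_map_contraction _ _ _ _ x 1 2) => //.
  - by move=> p p0; exact: mulr_gt0.
  - exact: ltr01.
  - exact: ltr0n.
  - by move=> /eqP; rewrite (eqr_nat R 1 2).
apply: (@hat_map_contraction _ _ _ _ x 1 (expR kappa)) => //.
- by move=> p [m pm]; rewrite /hat_space /= pm expR_gt0.
(* Multiplying a height by [lip f], which is [expR (kappa * m0)], shifts its exponent by [m0]. *)
- move=> p [m pm]; exists (m0 + m); rewrite /= pm.
  by rewrite intrD mulrDr expRD -lm0 lnK.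
(* The heights 1 and [expR kappa] are the lattice levels 0 and 1, distinct because [kappa] is
   positive. *)
- by exists 0; rewrite mulr0 expR0.
- by exists 1; rewrite mulr1.
- by move=> e1; have := expR_gt1 kappa; rewrite -e1 ltxx kappa0.
Qed.
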